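(* Let $I$ be an SF instance and let $\Pi$ be a GSP of $I$. Let $\mathcal{O}_I=\{\Pi_r\in\Pi : |A_r| \text{ is odd}\}$ be the set of cyclic permutations of odd length contained in $\Pi$. Then $\mathcal{O}_I$ is invariant: for every GSP $\Pi'$ of $I$, $\mathcal{O}_I\subseteq\Pi'$.
   Context: A Stable Fixtures (SF) instance is $I=(A,\succ,c)$ where $A=\{a_1,\dots,a_n\}$ is a finite set of $n$ agents; each agent $a_i$ has a strict linear order $\succ_i$ over $A\setminus\{a_i\}$ (complete preference list), with the convention that every agent ranks itself last ($a_j\succ_i a_i$ for all $j\neq i$); $a\succeq_i b$ means $a\succ_i b$ or $a=b$. Each agent has an integer capacity $c_i$ with $1\le c_i<n$. A cyclic permutation of a nonempty set $A_r\subseteq A$ is a permutation $\Pi_r$ of $A_r$ consisting of a single cycle of length $|A_r|$ (length 1: a fixed point $(a_i)$; length 2: a transposition $(a_i\ a_j)$). Two cyclic permutations are distinct if some element is mapped to different elements by them. A GSP (generalised stable partition) of $I$ is a finite collection $\Pi=\{\Pi_1,\dots,\Pi_k\}$ of cyclic permutations $\Pi_r$ of sets $A_r\subseteq A$, pairwise distinct except that fixed points may be repeated, such that: (F1) for every $r$ and every $a_j\in A_r$, $\Pi_r(a_j)\succeq_j\Pi_r^{-1}(a_j)$; (F2) there are no distinct $a_i,a_j\in A$ with the transposition $(a_i\ a_j)\notin\Pi$ such that $a_j\succ_i\Pi_r^{-1}(a_i)$ and $a_i\succ_j\Pi_s^{-1}(a_j)$ for some $\Pi_r,\Pi_s\in\Pi$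 with $a_i\in A_r$, $a_j\in A_s$; (F3) for every $a_i\in A$, the number of indices $r$ with $a_i\in A_r$ equals $c_i$; (F4) for all distinct $a_i,a_j\in A$, $|\{s:\Pi_s(a_i)=a_j\}|+|\{s:\Pi_s(a_j)=a_i\}|\le 2$. Cyclic permutations are compared as functions (so e.g. $(a_1\ a_2\ a_3)=(a_2\ a_3\ a_1)$). *)

(* Defs.v *)
(* MathComp. *)
From HB Require Import structures.
From mathcomp Require Import all_boot all_fingroup.

Set Implicit Arguments.
Unset Strict Implicit.
Unset Printing Implicit Defensive.

(* [pref i x y] reads "agent i strictly prefers x to y". *)
Record sf_instance (A : finType) := SFInstance {
  pref : A -> rel A;
  pref_irr : forall i, irreflexive (pref i);
  pref_trans : forall i, transitive (pref i);
  pref_total : forall i x y, x != y -> pref i x y || pref i y x;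
  pref_self_last : forall i j, j != i -> pref i j i;
  capacity : A -> nat;
  capacity_bounds : forall i, 1 <= capacity i < #|A|
}.

Definition weak_pref (A : finType) (I : sf_instance A) (i x y : A) : bool :=
  pref I i x y || (x == y).

(* A cyclic permutation of a set D is stored as D together with its extension
   to A by the identity; keeping D distinguishes the fixed points (a) from one
   another.  Since the extension is determined by the permutation of D, equality
   in [cycperm A] is equality of permutations as functions on their domains. *)
Definition is_cycperm (A : finType) (p : {set A} * {perm A}) : bool :=
  [&& p.1 != set0, perm_on p.1 p.2 & [forall x in p.1, porbit p.2 x == p.1]].

Record cycperm (A : finType) := CycPerm {
  cycpair : {set A} * {perm A};
  cycpairP : is_cycperm cycpair
}.

HB.instance Definition _ (A : finType) := [isSub for @cycpair A].
HB.instance Definition _ (A : finType) := [Finite of cycperm A by <:].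

Definition cycdom (A : finType) (r : cycperm A) : {set A} := (cycpair r).1.
Definition cycfun (A : finType) (r : cycperm A) : {perm A} := (cycpair r).2.

Lemma transposition_subproof (A : finType) (i j : A) :
  is_cycperm ([set i; j], tperm i j).
Proof.
rewrite /is_cycperm /=; apply/and3P; split.
- by apply/set0Pn; exists i; rewrite !inE eqxx.
- apply/subsetP => x; rewrite !inE; apply: contraR.
  rewrite negb_or => /andP[xi xj].
  by rewrite tpermD // eq_sym.
- apply/forall_inP => x; rewrite !inE => xij; rewrite eqEsubset.
  apply/andP; split; apply/subsetP => y.
  + case/porbitP => m ->; elim: m => [|m IH]; first by rewrite expg0 perm1 !inE.
    rewrite expgSr permM; move: IH; rewrite !inE.
    by case/orP => /eqP ->; rewrite ?tpermL ?tpermR eqxx ?orbT.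
  + rewrite !inE => yij; have [-> | nyx] := eqVneq y x; first exact: porbit_id.
    suff -> : y = tperm i j x by rewrite -{1}[tperm i j]expg1 mem_porbit.
    by move: xij yij nyx => /orP[]/eqP-> /orP[]/eqP->;
       rewrite ?tpermL ?tpermR ?eqxx.
Qed.

Definition transposition (A : finType) (i j : A) : cycperm A :=
  CycPerm (transposition_subproof i j).

(* The collection is a sequence, so that repeated fixed points are counted with
   multiplicity in [gsp_capacity]. *)
Record is_gsp (A : finType) (I : sf_instance A) (P : seq (cycperm A)) : Prop :=
  IsGSP {
  gsp_distinct : uniq [seq r <- P | #|cycdom r| != 1];
  gsp_weak_pref : forall r, r \in P -> forall j, j \in cycdom r ->
    weak_pref I j (cycfun r j) ((cycfun r)^-1%g j);
  gsp_no_blocking : ~ exists i j : A,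
    [/\ i != j, transposition i j \notin P
      & exists r s : cycperm A,
        [/\ r \in P, s \in P, i \in cycdom r, j \in cycdom s &
            pref I i j ((cycfun r)^-1%g i) && pref I j i ((cycfun s)^-1%g j)]];
  gsp_capacity : forall i, count (fun r => i \in cycdom r) P = capacity I i;
  gsp_pair_bound : forall i j, i != j ->
    count (fun s => (i \in cycdom s) && (cycfun s i == j)) P +
    count (fun s => (j \in cycdom s) && (cycfun s j == i)) P <= 2
}.

Definition odd_cycles (A : finType) (P : seq (cycperm A)) : {set cycperm A} :=
  [set r in P | odd #|cycdom r|].

(* Main.v *)
(* Each GSP induces a half-integral matching m, in which an arc i -> j gives
   weight 1/2 to the pair ij, and stability says that every pair of weight less
   than 1 is dominated by the worst predecessor w at one of its ends.  Given two
   GSPs, cancel the common weight. Each residual pair of m is weakly below w' at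
   one of its ends, and symmetrically, but at each vertex the residual weight
   that lies weakly below the other worst predecessor is at most half of the
   total residual weight there.  Double counting turns both inequalities into
   equalities.  On the loops this says that the fixed points agree.  On an arc
   i -> j of a cycle of length at least 3 (where i = w j), it says that either
   the arc is in such a cycle of the other GSP, and then so is the next arc, or
   exactly one of i and j strictly prefers w' to w.  Hence a cycle that is not
   shared alternates between two kinds of vertices and has even length. *)

Require Import Defs.
From HB Require Import structures.
From mathcomp Require Import all_boot all_fingroup.
From mathcomp Require Import zify.

Set Implicit Arguments.
Unset Strict Implicit.
Unset Printing Implicit Defensive.

(** * Weak preference as a total order *)

Lemma weak_prefNpref (A : finType) (I : sf_instance A) (i x y : A) :
  weak_pref I i x y = ~~ pref I i y x.
Proof.
rewrite /weak_pref; have [->|nxy] := eqVneq x y; first by rewrite pref_irr orbT.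
rewrite orbF; apply/idP/idP => [xy|].
  by apply/negP => yx; have := pref_trans xy yx; rewrite pref_irr.
by have /orP[//|->] := pref_total I i nxy.
Qed.

Lemma weak_pref_refl (A : finType) (I : sf_instance A) (i x : A) :
  weak_pref I i x x.
Proof. by rewrite /weak_pref eqxx orbT. Qed.

Lemma weak_pref_self (A : finType) (I : sf_instance A) (i x : A) :
  weak_pref I i x i.
Proof.
by rewrite /weak_pref; case: eqVneq => [|nxi]; rewrite ?orbT // pref_self_last.
Qed.

Lemma weak_pref_trans (A : finType) (I : sf_instance A) (i : A) :
  transitive (weak_pref I i).
Proof.
move=> y x z; rewrite /weak_pref => /orP[xy|/eqP-> //] /orP[yz|/eqP<-].
  by rewrite (pref_trans xy yz).
by rewrite xy.
Qed.

Lemma weak_pref_anti (A : finType) (I : sf_instance A) (i x y : A) :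
  weak_pref I i x y -> weak_pref I i y x -> x = y.
Proof.
by rewrite (weak_prefNpref I i y x) {1}/weak_pref => /orP[->//|/eqP].
Qed.

Lemma weak_pref_pref_trans (A : finType) (I : sf_instance A) (i x y z : A) :
  weak_pref I i x y -> pref I i y z -> pref I i x z.
Proof. by case/orP => [/pref_trans|/eqP->//]; apply. Qed.

(** * Double counting of residual weights *)

Lemma sum_sym (A : finType) (f : A -> A -> nat) (b : A -> A -> bool) :
  (forall i j, f i j = f j i) ->
  (\sum_i \sum_j f i j * b i j).*2 = \sum_i \sum_j f i j * (b i j + b j i).
Proof.
move=> fC; rewrite -addnn {2}exchange_big -big_split; apply: eq_bigr => i _.
by rewrite -big_split; apply: eq_bigr => j _ /=; rewrite mulnDr (fC j i).
Qed.

Lemma leq_sum_eq (T : finType) (f g : T -> nat) :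
  (forall i, f i <= g i) -> \sum_i g i <= \sum_i f i -> forall i, f i = g i.
Proof.
move=> le ge i; apply/eqP.
have [_] := leqif_sum (fun i (_ : true) => leqif_eq (le i)).
by rewrite eqn_leq ge leq_sum // => /esym/forallP/(_ i).
Qed.

(* [m i j] is twice the weight of the pair [ij] in the half-integral matching
   induced by a GSP, a fixed point [(i)] counting twice in [m i i]; [w i] is the
   worst predecessor of [i].  In comparing two such matchings, [m i j - m' i j]
   is truncated, so it is the residual weight of [m] over [m']. *)
Record stable_weight (A : finType) (I : sf_instance A)
    (m : A -> A -> nat) (w : A -> A) : Prop := StableWeight {
  weightC : forall i j, m i j = m j i;
  weight_sum : forall i, \sum_j m i j = (capacity I i).*2;
  weight_le2 : forall i j, i != j -> m i j <= 2;
  weight_worst : forall i, 0 < m i (w i);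
  weight_ge_worst : forall i j, 0 < m i j -> weak_pref I i j (w i);
  weight_stable : forall i j, i != j -> m i j < 2 ->
    weak_pref I i (w i) j || weak_pref I j (w j) i
}.

Lemma residual_degree (A : finType) (I : sf_instance A) m w m' w' (i : A) :
  stable_weight I m w -> stable_weight I m' w' ->
  \sum_j (m i j - m' i j) = \sum_j (m' i j - m i j).
Proof.
move=> S S'; apply/eqP; rewrite -(eqn_add2l (\sum_j m' i j)) -big_split /=.
rewrite (weight_sum S') -(weight_sum S) -big_split /=.
by apply/eqP/eq_bigr => j _; lia.
Qed.

Lemma residual_above (A : finType) (I : sf_instance A) m w n (i x : A) :
  stable_weight I m w -> pref I i (w i) x ->
  \sum_j (m i j - n j) * weak_pref I i x j = 0.
Proof.
move=> S wx; apply: big1 => j _.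
case: (posnP (m i j)) => [->//|/(weight_ge_worst S) wj].
by rewrite weak_prefNpref (weak_pref_pref_trans wj wx) muln0.
Qed.

Lemma residual_tie (A : finType) (I : sf_instance A) m w n (i : A) :
  stable_weight I m w ->
  \sum_j (m i j - n j) * weak_pref I i (w i) j = m i (w i) - n (w i).
Proof.
move=> S; rewrite (bigD1 (w i)) //= weak_pref_refl muln1 big1 ?addn0 // => j.
case: (posnP (m i j)) => [->//|/(weight_ge_worst S) jw].
case: (boolP (weak_pref I i (w i) j)) => [wj|]; last by rewrite muln0.
by rewrite (weak_pref_anti jw wj) eqxx.
Qed.

(** If one worst predecessor is strictly better, the sum over its own matching vanishes and the
    other is at most the common residual degree. If they tie, only the common worst predecessor
    contributes, and its two opposite truncated differences are not both positive. *)
Lemma residual_local (A : finType) (I : sf_instance A) m w m' w' (i : A) :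
  stable_weight I m w -> stable_weight I m' w' ->
  \sum_j (m i j - m' i j) * weak_pref I i (w' i) j +
  \sum_j (m' i j - m i j) * weak_pref I i (w i) j <= \sum_j (m i j - m' i j).
Proof.
wlog ww' : m w m' w' / weak_pref I i (w i) (w' i) => [wl S S'|S S'].
  have [/wl->//|] := boolP (weak_pref I i (w i) (w' i)).
  rewrite weak_prefNpref negbK => ww'.
  rewrite addnC (residual_degree _ S S'); apply: wl => //.
  by rewrite /weak_pref ww'.
case/orP: ww' => [ww'|/eqP ww'].
  rewrite (residual_above _ S ww') add0n (residual_degree _ S S').
  by apply: leq_sum => j _; case: weak_pref; rewrite ?muln1 ?muln0.
rewrite -ww' (residual_tie (m' i) i S) ww' (residual_tie (m i) i S') -ww'.
have le1 : m i (w i) - m' i (w i) <= \sum_j (m i j - m' i j).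
  by rewrite (bigD1 (w i)) //= leq_addr.
have le2 : m' i (w i) - m i (w i) <= \sum_j (m i j - m' i j).
  by rewrite (residual_degree _ S S') (bigD1 (w i)) //= leq_addr.
by lia.
Qed.

Lemma residual_edge_ge (A : finType) (I : sf_instance A) m w m' w' (i j : A) :
  stable_weight I m w -> stable_weight I m' w' -> m' i j < m i j ->
  0 < weak_pref I i (w' i) j + weak_pref I j (w' j) i.
Proof.
move=> S S' lt; have [<-|nij] := eqVneq i j; first by rewrite weak_pref_self.
have := weight_stable S' nij (leq_trans lt (weight_le2 S nij)).
by do 2 case: weak_pref.
Qed.

(* Summing [residual_local] over the vertices and [residual_edge_ge] over the
   edges gives opposite inequalities, so both hold with equality. *)
Lemma residual_tight (A : finType) (I : sf_instance A) m w m' w' :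
  stable_weight I m w -> stable_weight I m' w' ->
  (forall i, \sum_j (m i j - m' i j) * weak_pref I i (w' i) j +
     \sum_j (m' i j - m i j) * weak_pref I i (w i) j = \sum_j (m i j - m' i j))
  /\ (forall i j, m' i j < m i j ->
        weak_pref I i (w' i) j + weak_pref I j (w' j) i = 1).
Proof.
move=> S S'.
have edge n v n' v' : stable_weight I n v -> stable_weight I n' v' ->
  forall i j, n i j - n' i j <=
    (n i j - n' i j) * (weak_pref I i (v' i) j + weak_pref I j (v' j) i).
  move=> Sn Sn' i j; have [->//|lt] := posnP (n i j - n' i j).
  by rewrite leq_pmulr // (residual_edge_ge Sn Sn') // -subn_gt0.
have symr n v n' v' : stable_weight I n v -> stable_weight I n' v' ->
  forall i j, n i j - n' i j = n j i - n' j i.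
  by move=> Sn Sn' i j; rewrite (weightC Sn) (weightC Sn').
pose loc i := \sum_j (m i j - m' i j) * weak_pref I i (w' i) j +
     \sum_j (m' i j - m i j) * weak_pref I i (w i) j.
pose d i := \sum_j (m i j - m' i j).
pose e i j :=
  (m i j - m' i j) * (weak_pref I i (w' i) j + weak_pref I j (w' j) i).
have le_loc i : loc i <= d i by apply: residual_local.
have le_e i : d i <= \sum_j e i j.
  by apply: leq_sum => j _; apply: edge S S' _ _.
(* By [sum_sym], doubling turns vertex sums into edge sums; the edge bound is applied to the
   residual of [m'] over [m] only, whose degrees are again [d]. *)
have dbl : (\sum_i loc i).*2 >= \sum_i \sum_j e i j + \sum_i d i.
  rewrite /loc big_split doubleD !sum_sym; last 2 first.
  - exact: symr S' S.
  - exact: symr S S'.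
  rewrite leq_add2l; apply: leq_sum => i _; rewrite /d (residual_degree _ S S').
  by apply: leq_sum => j _; apply: edge S' S _ _.
have sum_loc : \sum_i loc i <= \sum_i d i by apply: leq_sum.
have sum_e : \sum_i d i <= \sum_i \sum_j e i j by apply: leq_sum.
(* With L, D, E the sums of [loc], [d], [e]: E + D <= 2L and L <= D <= E force L = D = E. *)
have [le_d_loc le_e_d] :
    \sum_i d i <= \sum_i loc i /\ \sum_i \sum_j e i j <= \sum_i d i.
  by move: dbl sum_loc sum_e; do 3 move: (\sum_i _); lia.
split=> [|i j lt]; first exact: leq_sum_eq.
have dE : d i = \sum_j e i j by apply: (leq_sum_eq le_e le_e_d).
have := @leq_sum_eq _ (fun j => m i j - m' i j) (e i) (edge _ _ _ _ S S' i).
rewrite -dE => /(_ (leqnn _) j) /eqP; rewrite /e.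
by rewrite -{1}[_ - _]muln1 eqn_pmul2l ?subn_gt0 // => /eqP<-.
Qed.

(** All [m']-partners of [i] lie strictly above [w i], so the second sum in the tight local equality
    is 0 and the first must collect the whole residual degree. *)
Lemma residual_worst_pref (A : finType) (I : sf_instance A) m w m' w'
    (i j : A) :
  stable_weight I m w -> stable_weight I m' w' ->
  pref I i (w' i) (w i) -> m' i j < m i j -> weak_pref I i (w' i) j.
Proof.
move=> S S' ww' lt; have [/(_ i) + _] := residual_tight S S'.
rewrite (residual_above _ S' ww') addn0 => loc.
have le k : (m i k - m' i k) * weak_pref I i (w' i) k <= m i k - m' i k.
  by case: weak_pref; rewrite ?muln1 ?muln0.
have := leq_sum_eq le _ j; rewrite loc leqnn => /(_ isT).
by case: weak_pref => //; lia.
Qed.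

Lemma residual_worst_eq (A : finType) (I : sf_instance A) m w m' w' (i : A) :
  stable_weight I m w -> stable_weight I m' w' -> w' i = w i ->
  \sum_j (m i j - m' i j) =
    (m i (w i) - m' i (w i)) + (m' i (w i) - m i (w i)).
Proof.
move=> S S' ww'; have [/(_ i) <- _] := residual_tight S S'.
by rewrite ww' (residual_tie (m' i) i S) -ww' (residual_tie (m i) i S').
Qed.

(** On a loop the two summands of the tight edge condition coincide, so they cannot add up to 1. *)
Lemma weight_diag_eq (A : finType) (I : sf_instance A) m w m' w' (i : A) :
  stable_weight I m w -> stable_weight I m' w' -> m i i = m' i i.
Proof.
move=> S S'; have [_ /(_ i i) e] := residual_tight S S'.
have [_ /(_ i i) e'] := residual_tight S' S.
by case: (ltngtP (m i i) (m' i i)) => // [/e'|/e]; case: weak_pref.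
Qed.

(** * Counting in sequences and cyclic permutations *)

Lemma count_gt0 (T : eqType) (a : pred T) (l : seq T) x :
  x \in l -> a x -> 0 < count a l.
Proof. by move=> xl ax; rewrite -has_count; apply/hasP; exists x. Qed.

Lemma count_gt1 (T : eqType) (a : pred T) (l : seq T) x y :
  x \in l -> y \in l -> x != y -> a x -> a y -> 1 < count a l.
Proof.
move=> xl yl nxy ax ay; rewrite -size_filter.
apply: (@uniq_leq_size _ [:: x; y]); first by rewrite /= inE nxy.
by move=> z; rewrite !inE mem_filter => /orP[]/eqP->; apply/andP.
Qed.

Lemma porbit_ind (T : finType) (p : {perm T}) (D : {pred T}) x :
  x \in D -> (forall y, y \in porbit p x -> y \in D -> p y \in D) ->
  {subset porbit p x <= D}.
Proof.
move=> xD step y /porbitP[n ->]; elim: n => [|n IH]; first by rewrite perm1.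
by rewrite expgSr permM step // mem_porbit.
Qed.

Section CyclicPermutations.

Variable A : finType.
Implicit Types r s : cycperm A.

Lemma porbit_cycdom r x : x \in cycdom r -> porbit (cycfun r) x = cycdom r.
Proof.
by case: r => -[D p] /= h xD; case/and3P: (h) => _ _ /forall_inP/(_ x xD)/eqP.
Qed.

Lemma cycfun_on r : perm_on (cycdom r) (cycfun r).
Proof. by case: r => -[D p] /= h; case/and3P: (h). Qed.

Lemma cycdom_cycfun r x : (cycfun r x \in cycdom r) = (x \in cycdom r).
Proof. exact: perm_closed (cycfun_on r). Qed.

Lemma cycdom_cycfunV r x : ((cycfun r)^-1%g x \in cycdom r) = (x \in cycdom r).
Proof. by rewrite -cycdom_cycfun permKV. Qed.

Lemma cycdom_ind r (D : {pred A}) x : x \in cycdom r -> x \in D ->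
  (forall y, y \in cycdom r -> y \in D -> cycfun r y \in D) ->
  {subset cycdom r <= D}.
Proof. by move=> /porbit_cycdom<-; apply: porbit_ind. Qed.

Lemma cycdom_indV r (D : {pred A}) x : x \in cycdom r -> x \in D ->
  (forall y, y \in cycdom r -> y \in D -> (cycfun r)^-1%g y \in D) ->
  {subset cycdom r <= D}.
Proof. by move=> /porbit_cycdom<-; rewrite -porbitV; apply: porbit_ind. Qed.

(** Agreement of predecessors spreads backwards from the common point [x] around both cycles.
    Predecessors are the useful side, since on long cycles they are the worst predecessors. *)
Lemma eq_cycpermV r s x : x \in cycdom r -> x \in cycdom s ->
  (forall y, y \in cycdom r -> y \in cycdom s ->
     (cycfun r)^-1%g y = (cycfun s)^-1%g y) -> r = s.
Proof.
move=> xr xs e.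
have rs : {subset cycdom r <= cycdom s}.
  by apply: cycdom_indV xr xs _ => y yr ys; rewrite e // cycdom_cycfunV.
have sr : {subset cycdom s <= cycdom r}.
  by apply: cycdom_indV xs xr _ => y ys yr; rewrite -e // cycdom_cycfunV.
have eD : cycdom r = cycdom s by apply/setP => y; apply/idP/idP => [/rs|/sr].
have eF : cycfun r = cycfun s.
  apply/invg_inj/permP => y; have [yr|ynr] := boolP (y \in cycdom r).
    by apply: e => //; apply: rs.
  rewrite !(out_perm _ ynr) //; last exact: perm_onV (cycfun_on r).
  by rewrite eD; apply: perm_onV (cycfun_on s).
apply: val_inj; rewrite /= [LHS]surjective_pairing [RHS]surjective_pairing.
by congr pair.
Qed.

(* On a cycle, the condition holds at one point iff it holds at all of them; it
   says that the length is at least 3. *)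
Definition long r := [forall y in cycdom r, cycfun r (cycfun r y) != y].

Lemma longP r x : long r -> x \in cycdom r -> cycfun r (cycfun r x) != x.
Proof. by move/forall_inP; apply. Qed.

Lemma long_neq r x : long r -> x \in cycdom r -> cycfun r x != x.
Proof. by move=> lr xr; apply: contraNneq (longP lr xr) => e; rewrite !e. Qed.

Lemma longI r x :
  x \in cycdom r -> cycfun r (cycfun r x) != x -> long r.
Proof.
move=> xr nx; apply/forall_inP => y yr; apply: contraNneq nx => yy.
suff : x \in [pred z | cycfun r (cycfun r z) == z] by rewrite inE.
apply: (@cycdom_ind r _ y yr _ _ x xr) => [|z _]; first by rewrite inE yy.
by rewrite !inE => /eqP->.
Qed.

Lemma long_card r : long r -> #|cycdom r| != 1.
Proof.
move=> lr; apply/negP => /cards1P[x e].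
have xr : x \in cycdom r by rewrite e set11.
by have := long_neq lr xr; rewrite -in_set1 -e cycdom_cycfun xr.
Qed.

Lemma odd_long r x :
  odd #|cycdom r| -> x \in cycdom r -> cycfun r x != x -> long r.
Proof.
move=> odr xr nx; apply: (longI xr); apply: contraTneq odr => xx.
suff -> : cycdom r = [set x; cycfun r x] by rewrite cards2 eq_sym nx.
apply/eqP; rewrite eqEsubset subUset !sub1set cycdom_cycfun xr /= andbT.
apply/subsetP => z; apply: (cycdom_ind xr) => [|y _]; first exact: set21.
by rewrite !inE => /orP[]/eqP->; rewrite ?xx eqxx ?orbT.
Qed.

(** The cycle maps its points satisfying [b] bijectively onto the others. *)
Lemma alternating_even r (b : pred A) :
  {in cycdom r, forall x, b (cycfun r x) = ~~ b x} -> ~~ odd #|cycdom r|.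
Proof.
move=> alt; rewrite -(cardsID [set x | b x]) oddD.
suff -> : cycdom r :\: [set x | b x] = cycfun r @: (cycdom r :&: [set x | b x]).
  by rewrite card_imset ?addbb //; apply: perm_inj.
apply/setP => y; apply/idP/imsetP => [|[x]].
  rewrite !inE => /andP[nby yr].
  exists ((cycfun r)^-1%g y); last by rewrite permKV.
  rewrite !inE cycdom_cycfunV yr /=; have := alt ((cycfun r)^-1%g y).
  rewrite cycdom_cycfunV permKV => /(_ yr); move: nby.
  by case: (b y); case: (b _).
by rewrite !inE => /andP[xr bx] ->; rewrite cycdom_cycfun xr alt // bx.
Qed.

End CyclicPermutations.

(** * The half-integral matching of a GSP *)

Section Gsp.

Variables (A : finType) (I : sf_instance A).
Implicit Types (P : seq (cycperm A)) (r s : cycperm A).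

Definition arcs P (i j : A) :=
  count (fun s => (i \in cycdom s) && (cycfun s i == j)) P.

Definition gsp_weight P (i j : A) := arcs P i j + arcs P j i.

Definition worst_predecessor P (i x : A) :=
  (exists r, [/\ r \in P, i \in cycdom r & (cycfun r)^-1%g i = x]) /\
  (forall r, r \in P -> i \in cycdom r ->
     weak_pref I i ((cycfun r)^-1%g i) x).

Lemma worst_in_seq (i x : A) l :
  exists2 y, y \in x :: l & {in x :: l, forall z, weak_pref I i z y}.
Proof.
elim: l x => [|z l IH] x.
  exists x => [|z]; first exact: mem_head.
  by rewrite inE => /eqP->; apply: weak_pref_refl.
have [y yl le] := IH z; have [xy|] := boolP (weak_pref I i x y).
  exists y => [|u]; first by rewrite inE yl orbT.
  by rewrite inE => /orP[/eqP->//|/le].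
rewrite weak_prefNpref negbK => yx; exists x => [|u]; first exact: mem_head.
rewrite inE => /orP[/eqP->|/le uy]; first exact: weak_pref_refl.
by rewrite /weak_pref (weak_pref_pref_trans uy yx).
Qed.

Lemma worst_predecessor_exists P :
  is_gsp I P -> exists w, forall i, worst_predecessor P i (w i).
Proof.
move=> hP; apply: fin_all_exists => i.
pose l := [seq (cycfun r)^-1%g i | r <- P & i \in cycdom r].
have: 0 < size l.
  rewrite size_map size_filter (gsp_capacity hP).
  by case/andP: (capacity_bounds I i).
case El: l => [//|x l'] _; have [y yl le] := worst_in_seq i x l'.
exists y; rewrite -El in yl le; split.
  by case/mapP: yl => r; rewrite mem_filter => /andP[ir rP] ->; exists r.
by move=> r rP ir; apply: le; apply/mapP; exists r; rewrite // mem_filter ir.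
Qed.

Lemma arcs_gt0P P i j :
  reflect (exists r, [/\ r \in P, i \in cycdom r & cycfun r i = j])
    (0 < arcs P i j).
Proof.
rewrite /arcs -has_count; apply: (iffP hasP) => [[r rP /andP[ir /eqP e]]|].
  by exists r.
by case=> r [rP ir e]; exists r; rewrite // ir e eqxx.
Qed.

Lemma arcs_gt0 P r i : r \in P -> i \in cycdom r -> 0 < arcs P i (cycfun r i).
Proof. by move=> rP ir; apply/arcs_gt0P; exists r. Qed.

Lemma sum_arcs_out P i : \sum_j arcs P i j = count (fun r => i \in cycdom r) P.
Proof.
under eq_bigr do rewrite /arcs -sum1_count big_mkcond.
rewrite exchange_big -sum1_count [RHS]big_mkcond; apply: eq_bigr => r _ /=.
case: (i \in cycdom r) => /=; last by rewrite big1.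
by rewrite -big_mkcond (eq_bigl (pred1 (cycfun r i))) ?big_pred1_eq // => j;
   rewrite /= eq_sym.
Qed.

Lemma sum_arcs_in P i : \sum_j arcs P j i = count (fun r => i \in cycdom r) P.
Proof.
under eq_bigr do rewrite /arcs -sum1_count big_mkcond.
rewrite exchange_big -sum1_count [RHS]big_mkcond; apply: eq_bigr => r _ /=.
rewrite -big_mkcond.
rewrite (eq_bigl (fun j => (j == (cycfun r)^-1%g i) && (i \in cycdom r))).
  by rewrite big_mkcondr big_pred1_eq.
move=> j; rewrite /= (can2_eq (permK _) (permKV _)) andbC.
by case: eqVneq => //= ->; rewrite cycdom_cycfunV.
Qed.

Section OneGsp.

Variable P : seq (cycperm A).
Hypothesis hP : is_gsp I P.

(** Otherwise the distinct cycles [r] and [s] both use the arc and [s] also uses its reverse: three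
    arcs on one pair, against (F4). *)
Lemma long_arc_not_matched r s i : r \in P -> s \in P -> long r ->
  i \in cycdom r -> i \in cycdom s -> cycfun s i = cycfun r i ->
  cycfun s (cycfun s i) = i -> False.
Proof.
move=> rP sP lr ir is_ sr ssi; set j := cycfun r i.
have nij : i != j by rewrite eq_sym (long_neq lr ir).
have nrs : r != s.
  by apply: contraNneq (longP lr ir) => ->; rewrite ssi.
have := gsp_pair_bound hP nij; rewrite leqNgt; case/negP.
apply: (@leq_add 2 1).
  by apply: (count_gt1 rP sP nrs); rewrite ?ir ?is_ ?sr eqxx.
by apply: (count_gt0 sP); rewrite /j -sr cycdom_cycfun is_ ssi eqxx.
Qed.

Variable w : A -> A.
Hypothesis hw : forall i, worst_predecessor P i (w i).

Lemma gsp_stable i j : i != j -> transposition i j \notin P ->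
  weak_pref I i (w i) j || weak_pref I j (w j) i.
Proof.
move=> nij tP; rewrite !weak_prefNpref -negb_and; apply/negP => /andP[ij ji].
have [[r [rP ir er]] _] := hw i; have [[s [sP js es]] _] := hw j.
apply: (gsp_no_blocking hP); exists i, j; split=> //.
by exists r, s; rewrite er es ij ji.
Qed.

(** By (F1) successors are no worse than predecessors, so the worst predecessor is the worst partner
    overall. A transposition gives an arc each way, so weight below 2 makes (F2) applicable. *)
Lemma gsp_stable_weight : stable_weight I (gsp_weight P) w.
Proof.
split=> [i j|i|i j|i|i j|i j nij lt2].
- exact: addnC.
- by rewrite big_split /= sum_arcs_out sum_arcs_in (gsp_capacity hP) addnn.
- by move=> nij; apply: (gsp_pair_bound hP nij).
- have [[r [rP ir <-]] _] := hw i; rewrite addn_gt0; apply/orP; right.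
  by apply/arcs_gt0P; exists r; rewrite cycdom_cycfunV permKV.
- have [_ le] := hw i; rewrite addn_gt0 => /orP[]/arcs_gt0P[r [rP]].
    move=> ir <-; apply: weak_pref_trans (le r rP ir).
    exact: (gsp_weak_pref hP rP ir).
  move=> jr e; have ir : i \in cycdom r by rewrite -e cycdom_cycfun.
  by have := le r rP ir; rewrite -{2}e permK.
apply: gsp_stable nij _; apply: contraL lt2 => tP; rewrite -leqNgt.
have := arcs_gt0 tP (set21 i j); have := arcs_gt0 tP (set22 i j).
by rewrite /= tpermL tpermR /gsp_weight; lia.
Qed.

(* For an arc [h -> i] of a long cycle, [h] prefers [i] to its own predecessor,
   so stability of the pair [hi] can only hold at [i]. *)
Lemma long_pred_worst r i :
  r \in P -> long r -> i \in cycdom r -> (cycfun r)^-1%g i = w i.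
Proof.
move=> rP lr ir; set h := (cycfun r)^-1%g i.
have hr : h \in cycdom r by rewrite cycdom_cycfunV.
have rh : cycfun r h = i by rewrite permKV.
have nhi : h != i by rewrite -rh eq_sym (long_neq lr hr).
apply: (@weak_pref_anti _ I i); first by have [_] := hw i; apply.
have /orP[hi|//] : weak_pref I h (w h) i || weak_pref I i (w i) h.
  apply: gsp_stable nhi _; apply/negP => tP.
  apply: (long_arc_not_matched rP tP lr hr); rewrite ?set21 //= tpermL //.
  by rewrite tpermR.
(* Stability at [h] would put its predecessor weakly above its successor [i]; by (F1) the two
   coincide, which a long cycle forbids. *)
have [_ /(_ r rP hr) le] := hw h.
have ge := gsp_weak_pref hP rP hr; rewrite rh in ge.
have e : (cycfun r)^-1%g h = i.
  exact: weak_pref_anti (weak_pref_trans le hi) ge.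
have ri : cycfun r i = h by rewrite -e permKV.
by have := longP lr hr; rewrite rh ri eqxx.
Qed.

Lemma long_succ_pref r i : r \in P -> long r -> i \in cycdom r ->
  pref I i (cycfun r i) (w i).
Proof.
move=> rP lr ir; have := gsp_weak_pref hP rP ir.
rewrite -(long_pred_worst rP lr ir); case/orP => // /eqP e.
by have := longP lr ir; rewrite e permKV eqxx.
Qed.

Lemma long_disjoint r s i : r \in P -> s \in P -> long r -> long s ->
  i \in cycdom r -> i \in cycdom s -> r = s.
Proof.
move=> rP sP lr ls ir is_; apply: (eq_cycpermV ir is_) => y yr ys.
by rewrite (long_pred_worst rP lr yr) (long_pred_worst sP ls ys).
Qed.

Lemma weight_long_arc r i : r \in P -> long r -> i \in cycdom r ->
  gsp_weight P i (cycfun r i) = 1.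
Proof.
move=> rP lr ir; have pos := arcs_gt0 rP ir.
(* Any cycle through this arc is long, hence equal to [r], which occurs only once in [P]. *)
have le1 : arcs P i (cycfun r i) <= 1.
  have -> : arcs P i (cycfun r i) = count_mem r P.
    apply: eq_in_count => s sP; apply/andP/eqP => [[is_ /eqP e]|->//].
    have [ss|ns] := eqVneq (cycfun s (cycfun s i)) i.
      by case: (long_arc_not_matched rP sP lr ir is_ e ss).
    exact: long_disjoint sP rP (longI is_ ns) lr is_ ir.
  have := count_uniq_mem r (gsp_distinct hP).
  rewrite count_filter mem_filter (long_card lr) rP /= => <-.
  by apply: sub_count => s /= /eqP->; rewrite eqxx long_card.
suff : arcs P (cycfun r i) i = 0 by rewrite /gsp_weight; lia.
apply/eqP; rewrite eqn0Ngt; apply/negP => /arcs_gt0P[s [sP js e]].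
have is_ : i \in cycdom s by rewrite -e cycdom_cycfun.
have [ss|ns] := eqVneq (cycfun s i) (cycfun r i).
  by apply: (long_arc_not_matched rP sP lr ir is_ ss); rewrite ss.
have ls : long s by apply: (longI js); rewrite e.
have rs := long_disjoint rP sP lr ls ir is_.
by rewrite rs eqxx in ns.
Qed.

Lemma arc_long_or_matched r i : r \in P -> i \in cycdom r ->
  gsp_weight P i (cycfun r i) < 2 -> long r.
Proof.
move=> rP ir; have [e|/(longI ir)//] := eqVneq (cycfun r (cycfun r i)) i.
have jr : cycfun r i \in cycdom r by rewrite cycdom_cycfun.
by have := arcs_gt0 rP ir; have := arcs_gt0 rP jr; rewrite e /gsp_weight; lia.
Qed.

Lemma weight1_long i j : gsp_weight P i j = 1 -> exists r,
  [/\ r \in P, long r & (i \in cycdom r /\ cycfun r i = j) \/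
                        (j \in cycdom r /\ cycfun r j = i)].
Proof.
move=> e; have : 0 < arcs P i j + arcs P j i by rewrite -/(gsp_weight P i j) e.
rewrite addn_gt0 => /orP[]/arcs_gt0P[r [rP xr rx]]; exists r; split=> //.
- by apply: (arc_long_or_matched rP xr); rewrite rx e.
- by left.
- apply: (arc_long_or_matched rP xr).
  by rewrite rx /gsp_weight addnC -/(gsp_weight P i j) e.
- by right.
Qed.

End OneGsp.

(** * Comparing the cycles of two GSPs *)

Section TwoGsps.

Variables (P P' : seq (cycperm A)).
Hypotheses (hP : is_gsp I P) (hP' : is_gsp I P').

Lemma gsp_fixed_point r i : r \in P -> i \in cycdom r -> cycfun r i = i ->
  r \in P'.
Proof.
move=> rP ir ri; have [w hw] := worst_predecessor_exists hP.
have [w' hw'] := worst_predecessor_exists hP'.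
have e :=
  weight_diag_eq i (gsp_stable_weight hP hw) (gsp_stable_weight hP' hw').
have : 0 < gsp_weight P' i i.
  by rewrite -e addn_gt0 -{2}ri (arcs_gt0 rP ir).
rewrite addn_gt0 orbb => /arcs_gt0P[s [sP is_ si]].
suff -> : r = s by [].
apply: (eq_cycpermV ir is_) => y yr _.
suff -> : y = i by rewrite -{1}ri -{2}si !permK.
apply/eqP; rewrite -in_set1; apply: (cycdom_ind ir) yr => [|z _].
  exact: set11.
by rewrite !in_set1 => /eqP->; rewrite ri.
Qed.

Variables (w w' : A -> A).
Hypotheses (hw : forall i, worst_predecessor P i (w i)).
Hypotheses (hw' : forall i, worst_predecessor P' i (w' i)).

Let S := gsp_stable_weight hP hw.
Let S' := gsp_stable_weight hP' hw'.

Variable r : cycperm A.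
Hypotheses (rP : r \in P) (lr : long r).

Definition long_arc_in (i : A) :=
  has (fun s => [&& long s, i \in cycdom s & cycfun s i == cycfun r i]) P'.

Lemma worst_cycfun i : i \in cycdom r -> w (cycfun r i) = i.
Proof.
by move=> ir; rewrite -(long_pred_worst hP hw rP lr) ?permK ?cycdom_cycfun.
Qed.

Lemma long_arc_worst i : i \in cycdom r -> long_arc_in i -> w' (cycfun r i) = i.
Proof.
move=> ir /hasP[s sP /and3P[ls is_ /eqP <-]].
by rewrite -(long_pred_worst hP' hw' sP ls) ?permK ?cycdom_cycfun.
Qed.

(** At the head [j] of a shared arc, both GSPs have worst predecessor [i] with weight 1, so no
    residual is left at [j] and the next pair also has weight 1 in [P']. *)
Lemma long_arc_in_step i :
  i \in cycdom r -> long_arc_in i -> long_arc_in (cycfun r i).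
Proof.
move=> ir ari; set j := cycfun r i.
have jr : j \in cycdom r by rewrite cycdom_cycfun.
have wj : w j = i by apply: worst_cycfun.
have w'j : w' j = i by apply: long_arc_worst.
have mj : gsp_weight P j i = 1.
  by rewrite (weightC S) (weight_long_arc hP hw rP lr ir).
have m'j : gsp_weight P' j i = 1.
  rewrite (weightC S'); case/hasP: ari => s sP /and3P[ls is_ /eqP e].
  by rewrite /j -e (weight_long_arc hP' hw' sP ls is_).
have D0 : \sum_k (gsp_weight P j k - gsp_weight P' j k) = 0.
  by rewrite (residual_worst_eq S S') ?wj ?w'j // mj m'j.
have D0' : \sum_k (gsp_weight P' j k - gsp_weight P j k) = 0.
  by rewrite -(residual_degree j S S').
set k := cycfun r j.
have mk : gsp_weight P j k = 1 by apply: (weight_long_arc hP hw rP lr jr).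
have m'k : gsp_weight P' j k = 1.
  move/eqP: D0; rewrite sum_nat_eq0 => /forallP/(_ k).
  move/eqP: D0'; rewrite sum_nat_eq0 => /forallP/(_ k).
  by rewrite mk; lia.
have [s [sP ls [[js sj]|[ks sk]]]] := weight1_long m'k.
  by apply/hasP; exists s; rewrite // ls js sj eqxx.
(* Were the arc reversed in [P'], its tail [k] would be [w' j = i], and [r] would return to [i]
   after two steps. *)
have := long_pred_worst hP' hw' sP ls (i := j).
rewrite -sk cycdom_cycfun permK sk w'j => /(_ ks) e.
by have := longP lr ir; rewrite -/j -/k e eqxx.
Qed.

(** The pair has weight 0 in [P'], so it is residual and tight. Its single satisfied end is [j],
    whereas a strict preference at [i] would satisfy the other end as well. *)
Lemma worst_pref_step i : i \in cycdom r ->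
  pref I (cycfun r i) (w' (cycfun r i)) (w (cycfun r i)) ->
  ~~ pref I i (w' i) (w i).
Proof.
move=> ir; set j := cycfun r i; rewrite (worst_cycfun ir) -/j => bj.
have mi : gsp_weight P i j = 1 by apply: (weight_long_arc hP hw rP lr ir).
have m'i : gsp_weight P' i j = 0.
  apply/eqP; rewrite (weightC S') eqn0Ngt; apply: contraL bj => pos.
  by rewrite -weak_prefNpref (weight_ge_worst S' pos).
have lt : gsp_weight P' i j < gsp_weight P i j by rewrite mi m'i.
have [_ /(_ i j lt)] := residual_tight S S'.
rewrite [X in _ + X](_ : _ = 1); last by rewrite /weak_pref bj.
move=> e; apply/negP => bi; move: e.
by rewrite (residual_worst_pref S S' bi lt).
Qed.

Lemma worst_npref_step i : i \in cycdom r -> ~~ long_arc_in i ->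
  ~~ pref I (cycfun r i) (w' (cycfun r i)) (w (cycfun r i)) ->
  pref I i (w' i) (w i).
Proof.
move=> ir nari; set j := cycfun r i.
rewrite (worst_cycfun ir) -/j -weak_prefNpref => bj.
have mi : gsp_weight P i j = 1 by apply: (weight_long_arc hP hw rP lr ir).
have jw : pref I i j (w i) by apply: (long_succ_pref hP hw rP lr ir).
have m'pos : 0 < gsp_weight P' i (w' i) by apply: weight_worst S' i.
(* Weight 0: tightness at [j] would make [i] equal to [w' j], a partner of positive weight, so it
   holds at [i]. Weight 1: a long cycle of [P'] runs from [j] to [i], so [w' i] is [j]. Larger
   weight: the residual of [P'] over [P] is compared at [i]. *)
case Em: (gsp_weight P' i j) => [|[|n]].
- have lt : gsp_weight P' i j < gsp_weight P i j by rewrite mi Em.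
  have [_ /(_ i j lt)] := residual_tight S S'.
  case: (boolP (weak_pref I j (w' j) i)) => [ji _|_].
    have := weight_worst S' j; rewrite -(weak_pref_anti bj ji).
    by rewrite (weightC S') Em.
  rewrite addn0; case: (boolP (weak_pref I i (w' i) j)) => // w'j _.
  exact: weak_pref_pref_trans w'j jw.
- have [s [sP ls [[is_ si]|[js sj]]]] := weight1_long Em.
    by case/hasP: nari; exists s; rewrite // ls is_ si eqxx.
  suff -> : w' i = j by [].
  by rewrite -(long_pred_worst hP' hw' sP ls) -sj ?permK ?cycdom_cycfun.
have lt : gsp_weight P i j < gsp_weight P' i j by rewrite mi Em.
have [//|] := boolP (pref I i (w' i) (w i)).
rewrite -weak_prefNpref => /orP[ww'|/eqP ww'].
  have := residual_worst_pref S' S ww' lt.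
  by rewrite weak_prefNpref jw.
have mw : gsp_weight P i (w i) = 1.
  set h := (cycfun r)^-1%g i.
  have hr : h \in cycdom r by rewrite cycdom_cycfunV.
  rewrite -(long_pred_worst hP hw rP lr ir) -/h (weightC S).
  by have := weight_long_arc hP hw rP lr hr; rewrite permKV.
have njw : j != w i by apply: contraTneq jw => ->; rewrite pref_irr.
(* In a tie the residual at [i] is concentrated on [w i]: since [P] has weight 1 there and [P'] at
   least 1, nothing remains for the excess on [j]. *)
have := residual_worst_eq S' S ww'; rewrite -ww' in m'pos *.
rewrite (bigD1 j) //= (bigD1 (w i)) 1?eq_sym //= mw.
by move: lt m'pos; lia.
Qed.

(** One shared arc propagates around [r] and makes [r] a cycle of [P']; with no shared arc, strict
    preference for [w'] alternates along [r], contradicting odd length. *)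
Lemma gsp_long_odd : odd #|cycdom r| -> r \in P'.
Proof.
move=> oddr; have [/existsP[x /andP[xr arx]]|none] :=
  boolP [exists x, (x \in cycdom r) && long_arc_in x]; last first.
  apply: contraTT oddr => _.
  apply: (@alternating_even _ r (fun i => pref I i (w' i) (w i))) => i ir.
  have nari : ~~ long_arc_in i.
    by apply: contraNN none => ari; apply/existsP; exists i; rewrite ir.
  have := worst_pref_step ir; have := worst_npref_step ir nari.
  by case: (pref I (cycfun r i) _ _) => [_ ->|->].
have all_arcs : {subset cycdom r <= long_arc_in}.
  by apply: (cycdom_ind xr arx) => y yr ary; apply: long_arc_in_step.
have /hasP[s sP /and3P[ls xs _]] := arx.
suff -> : r = s by [].
apply: (eq_cycpermV xr xs) => y yr ys.
have hr : (cycfun r)^-1%g y \in cycdom r by rewrite cycdom_cycfunV.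
rewrite (long_pred_worst hP' hw' sP ls ys) -{2}(permKV (cycfun r) y).
by rewrite long_arc_worst //; apply: all_arcs.
Qed.

End TwoGsps.

End Gsp.

Theorem theorem10 (A : finType) (I : sf_instance A) (P : seq (cycperm A))
    (hP : is_gsp I P) :
  forall P' : seq (cycperm A), is_gsp I P' ->
    {subset odd_cycles P <= P'}.
Proof.
move=> P' hP' r; rewrite inE => /andP[rP oddr].
have /card_gt0P[i ir] : 0 < #|cycdom r| by case: #|_| oddr.
have [ri|nri] := eqVneq (cycfun r i) i.
  exact: (gsp_fixed_point hP hP' rP ir ri).
have [w hw] := worst_predecessor_exists hP.
have [w' hw'] := worst_predecessor_exists hP'.
exact: (gsp_long_odd hP hP' hw hw' rP (odd_long oddr ir nri) oddr).
Qed.
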